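(* For each integer $d\geq3$, it holds that $c_2(\ell^2(\mathbb{N};\mathbb{R}^d)/\!/S_\infty)=\infty$. That is, $\ell^2(\mathbb{N};\mathbb{R}^d)/\!/S_\infty$ has no bilipschitz embedding into any Hilbert space.
   Context: $\ell^2(\mathbb{N};\mathbb{R}^d)$ is the real Hilbert space of sequences of vectors in $\mathbb{R}^d$ whose norms are square summable, and $S_\infty$ is the group of all bijections $\mathbb{N}\to\mathbb{N}$, acting by permuting the index set. The metric quotient $\ell^2(\mathbb{N};\mathbb{R}^d)/\!/S_\infty$ has as points the closures $[x]=\overline{S_\infty\cdot x}$ of orbits, with metric $d([x],[y])=\inf\{\|p-q\|_{\ell^2}:p\in S_\infty\cdot x,\ q\in S_\infty\cdot y\}$. The Euclidean distortion $c_2(X)\in[1,\infty]$ of a metric space $X$ is the infimum of all $c$ for which there exist a Hilbert space $H$, a map $f\colon X\to H$ and a constant $\alpha>0$ such that $\alpha\, d_X(x,x')\leq\|f(x)-f(x')\|\leq c\,\alpha\, d_X(x,x')$ for all $x,x'\in X$ (the infimum of the empty set being $\infty$); a map $f$ is bilipschitz if it satisfies such inequalities for some $\alpha>0$ and $c<\infty$. *)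

(* Defs.v *)
From HB Require Import structures.
From mathcomp Require Import all_boot all_order all_algebra.
From mathcomp Require Import all_classical all_reals all_analysis.
Set Implicit Arguments.
Unset Strict Implicit.
Unset Printing Implicit Defensive.
Import Order.TTheory GRing.Theory Num.Theory.
Import numFieldNormedType.Exports.
Local Open Scope classical_set_scope.
Local Open Scope ring_scope.

Section Distortion.
Context {R : realType}.

(* The inner product is determined by the norm (polarization), so being a
   Hilbert space is a property of a complete normed space over R. *)
Definition is_hilbert (H : completeNormedModType R) : Prop :=
  exists dot : {dot H for idfun}, forall u : H, `|u| ^+ 2 = dot u u.

Definition bilipschitz_with (X : metricType R) (H : normedModType R)
    (alpha c : R) (f : X -> H) : Prop :=
  forall x x' : X,
    alpha * mdist x x' <= `|f x - f x'| /\
    `|f x - f x'| <= c * alpha * mdist x x'.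

Definition bilipschitz (X : metricType R) (H : normedModType R)
    (f : X -> H) : Prop :=
  exists alpha c : R, 0 < alpha /\ bilipschitz_with alpha c f.

(* As soon as X has two points, c >= 1 is automatic; imposing it only serves to
   make c2 take values in [1, +oo] when X has at most one point. *)
Definition c2 (X : metricType R) : \bar R :=
  ereal_inf [set c%:E | c in [set c : R | 1 <= c /\
    exists H : completeNormedModType R, is_hilbert H /\
    exists (f : X -> H) (alpha : R), 0 < alpha /\ bilipschitz_with alpha c f]].

End Distortion.

Section FiniteMinkowski.
Context {R : realType} (I : finType).
Implicit Types a b : I -> R.

Lemma minkowski_fin a b :
  Num.sqrt (\sum_i (a i + b i) ^+ 2) <=
  Num.sqrt (\sum_i a i ^+ 2) + Num.sqrt (\sum_i b i ^+ 2).
Proof.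
have sq_ge0 (f : I -> R) : 0 <= \sum_i f i ^+ 2.
  by apply: sumr_ge0 => i _; exact: sqr_ge0.
have sq0 (f : I -> R) : Num.sqrt (\sum_i f i ^+ 2) = 0 -> forall i, f i = 0.
  move/eqP; rewrite sqrtr_eq0 => le0 i.
  have /eqP : \sum_i f i ^+ 2 = 0 by apply/eqP; rewrite eq_le le0 sq_ge0.
  rewrite psumr_eq0 => [/allP/(_ i)|j _]; last exact: sqr_ge0.
  by rewrite mem_index_enum sqrf_eq0 => /(_ isT)/eqP.
set A := \sum_i a i ^+ 2; set B := \sum_i b i ^+ 2.
set sA := Num.sqrt A; set sB := Num.sqrt B.
have sA2 : sA ^+ 2 = A by rewrite sqr_sqrtr// /A sq_ge0.
have sB2 : sB ^+ 2 = B by rewrite sqr_sqrtr// /B sq_ge0.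
have sA0 : 0 <= sA := sqrtr_ge0 _.
have sB0 : 0 <= sB := sqrtr_ge0 _.
set C := \sum_i a i * b i.
have CS : C <= sA * sB.
  have [a0|an0] := eqVneq sA 0.
    by rewrite a0 mul0r /C big1// => i _; rewrite (sq0 _ a0) mul0r.
  have [b0|bn0] := eqVneq sB 0.
    by rewrite b0 mulr0 /C big1// => i _; rewrite (sq0 _ b0) mulr0.
  have sAB : 0 < sA * sB by rewrite mulr_gt0// lt_neqAle eq_sym ?an0 ?bn0.
  have := sq_ge0 (fun i => sB * a i - sA * b i).
  have -> : \sum_i (sB * a i - sA * b i) ^+ 2 =
      sB ^+ 2 * A - (sA * sB * C) *+ 2 + sA ^+ 2 * B.
    rewrite /A /B /C !mulr_sumr -sumrMnl -sumrB -big_split/=.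
    apply: eq_bigr => i _; rewrite sqrrB !exprMn; congr (_ - _ *+ 2 + _).
    by rewrite mulrACA [sB * _]mulrC.
  rewrite sA2 sB2 [B * A]mulrC addrAC -mulr2n -mulrnBl pmulrn_lge0//.
  by rewrite -sA2 -sB2 -exprMn expr2 -mulrBr pmulr_rge0// subr_ge0.
rewrite -[leRHS]ger0_norm ?addr_ge0// -sqrtr_sqr ler_wsqrtr//.
rewrite sqrrD sA2 sB2.
under eq_bigr do rewrite sqrrD.
rewrite !big_split/= -/A -/B lerD2r lerD2l.
by rewrite mulr2n lerD.
Qed.

End FiniteMinkowski.

Section L2.
Context {R : realType} {d : nat}.
Implicit Types (x y : nat -> 'rV[R]_d).

(* The library norm on 'rV[R]_d is the sup norm, not this one. *)
Definition enorm (v : 'rV[R]_d) : R := Num.sqrt (\sum_i v ord0 i ^+ 2).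

Definition sqsum x : \bar R := (\sum_(0 <= n <oo) (enorm (x n) ^+ 2)%:E)%E.

Definition square_summable : {pred nat -> 'rV[R]_d} :=
  fun x => (sqsum x < +oo)%E.

Lemma square_summableE x : (x \in square_summable) = (sqsum x < +oo)%E.
Proof. by []. Qed.

Let term_ge0 x n : (0 <= (enorm (x n) ^+ 2)%:E)%E.
Proof. by rewrite lee_fin sqr_ge0. Qed.

Lemma sqsum_ge0 x : (0 <= sqsum x)%E.
Proof. by apply: nneseries_ge0 => n _ _; exact: term_ge0. Qed.

Lemma sqsum_fin x : x \in square_summable -> sqsum x \is a fin_num.
Proof. by rewrite ge0_fin_numE ?sqsum_ge0. Qed.

Let nrm x := Num.sqrt (fine (sqsum x)).

Lemma sqsumE x : x \in square_summable -> sqsum x = (nrm x ^+ 2)%:E.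
Proof.
move=> sx; rewrite /nrm sqr_sqrtr ?fine_ge0 ?sqsum_ge0//.
by rewrite fineK// sqsum_fin.
Qed.

Lemma enormE v : enorm v ^+ 2 = \sum_i v ord0 i ^+ 2.
Proof. by rewrite sqr_sqrtr// sumr_ge0// => i _; rewrite sqr_ge0. Qed.

Lemma enormZ (a : R) v : enorm (a *: v) ^+ 2 = a ^+ 2 * enorm v ^+ 2.
Proof.
by rewrite !enormE mulr_sumr; apply: eq_bigr => i _; rewrite mxE exprMn.
Qed.

Let part x N := \sum_(p : 'I_N * 'I_d) x p.1 ord0 p.2 ^+ 2.

Lemma partE x N : (\sum_(0 <= n < N) (enorm (x n) ^+ 2)%:E)%E = (part x N)%:E.
Proof.
rewrite sumEFin big_mkord /part; congr (_%:E).
under eq_bigr do rewrite enormE.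
by rewrite pair_bigA.
Qed.

Lemma part_le x N : x \in square_summable -> Num.sqrt (part x N) <= nrm x.
Proof.
move=> sx; rewrite -[leRHS]ger0_norm ?sqrtr_ge0// -sqrtr_sqr ler_wsqrtr//.
rewrite -lee_fin -partE -sqsumE//.
by apply: nneseries_lim_ge => n _ _; exact: term_ge0.
Qed.

Lemma sqsumD x y : x \in square_summable -> y \in square_summable ->
  (sqsum (x + y)%R <= ((nrm x + nrm y) ^+ 2)%:E)%E.
Proof.
move=> sx sy; apply: lime_le.
  by apply: is_cvg_nneseries => n _ _; exact: term_ge0.
apply: nearW => N; rewrite partE lee_fin.
have p0 : 0 <= part (x + y) N by apply: sumr_ge0 => p _; exact: sqr_ge0.
rewrite -[leLHS]sqr_sqrtr// lerXn2r ?nnegrE ?sqrtr_ge0 ?addr_ge0 ?sqrtr_ge0//.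
apply: (le_trans _ (lerD (part_le N sx) (part_le N sy))).
apply: le_trans (minkowski_fin _ _).
by rewrite le_eqVlt; apply/orP; left; apply/eqP; congr Num.sqrt;
  apply: eq_bigr => p _; rewrite /= mxE.
Qed.

Lemma sqsumZ (a : R) x : sqsum (a *: x) = ((a ^+ 2)%:E * sqsum x)%E.
Proof.
rewrite /sqsum -nneseriesZl; last by move=> n _; exact: term_ge0.
by apply: eq_eseriesr => n _; rewrite -EFinM -enormZ.
Qed.

Lemma sqsum0 : sqsum 0 = 0%E.
Proof. by rewrite -[0](scale0r 0) sqsumZ expr0n mul0e. Qed.

Lemma square_summable_submod : submod_closed square_summable.
Proof.
split=> [|a x y sx sy]; first by rewrite square_summableE sqsum0 ltry.
have sax : a *: x \in square_summable.
  by rewrite square_summableE sqsumZ (sqsumE sx) -EFinM ltry.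
by rewrite square_summableE (le_lt_trans (sqsumD sax sy))// ltry.
Qed.

HB.instance Definition _ :=
  GRing.isSubmodClosed.Build _ _ square_summable square_summable_submod.

(* The space l^2(N; R^d), normed below by (sum_n |x_n|^2)^(1/2). *)
Record l2 := L2 { l2val :> nat -> 'rV[R]_d ; _ : l2val \in square_summable }.

HB.instance Definition _ := [isSub for l2val].
HB.instance Definition _ := [Choice of l2 by <:].
HB.instance Definition _ := [SubChoice_isSubLmodule of l2 by <:].

Implicit Types (u v w : l2).

Definition l2norm u : R := Num.sqrt (fine (sqsum u)).

Lemma l2normD u v : l2norm (u + v) <= l2norm u + l2norm v.
Proof.
rewrite -(@ler_pXn2r _ 2) ?nnegrE ?addr_ge0 ?sqrtr_ge0// -lee_fin.
rewrite -(sqsumE (valP (u + v))); exact: sqsumD (valP u) (valP v).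
Qed.

Lemma l2normZ (a : R) u : l2norm (a *: u) = `|a| * l2norm u.
Proof.
rewrite /l2norm sqsumZ fineM// ?sqsum_fin ?(valP u)//=.
by rewrite sqrtrM ?sqr_ge0// sqrtr_sqr.
Qed.

Lemma l2norm_eq0 u : l2norm u = 0 -> u = 0.
Proof.
move=> u0; apply/val_inj/funext => n; apply/rowP => i /=; rewrite mxE.
have : Num.sqrt (part u n.+1) <= l2norm u := part_le n.+1 (valP u).
rewrite u0 => le0.
have part0 : part u n.+1 <= 0 by rewrite -sqrtr_eq0 eq_le le0 sqrtr_ge0.
have : part u n.+1 = 0.
  by apply/eqP; rewrite eq_le part0/= sumr_ge0// => p _; exact: sqr_ge0.
move/eqP; rewrite psumr_eq0; last by move=> p _; exact: sqr_ge0.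
move/allP/(_ (ord_max, i)); rewrite mem_index_enum sqrf_eq0/=.
by move=> /(_ isT)/eqP.
Qed.

HB.instance Definition _ :=
  Lmodule_isNormed.Build R l2 l2normD l2normZ l2norm_eq0.

Lemma l2_normE u :
  `|u| = Num.sqrt (fine (\sum_(0 <= n <oo) (enorm (u n) ^+ 2)%:E)%E).
Proof. by []. Qed.

Lemma sqsum_perm x (s : nat -> nat) : bijective s -> sqsum (x \o s) = sqsum x.
Proof.
move=> bs; rewrite /sqsum !nneseries_esumT//=.
rewrite [RHS](@reindex_esum _ _ _ setT setT s)//.
by rewrite setTT_bijective.
Qed.

Lemma l2perm_subproof (s : nat -> nat) u : bijective s ->
  val u \o s \in square_summable.
Proof. by move=> bs; rewrite square_summableE sqsum_perm//; exact: (valP u). Qed.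

(* The orbit of u under all bijections of N; {u \o s^-1 | s} = {u \o s | s}. *)
Definition orbit u : set l2 :=
  [set v | exists s : nat -> nat, bijective s /\ val v = val u \o s].

Lemma orbit_refl u : orbit u u.
Proof. by exists id; split => //; exists id. Qed.

Lemma orbit_sym u v : orbit u v -> orbit v u.
Proof.
move=> [s [[t st ts] vu]]; exists t; split; first by exists s.
by rewrite vu; apply/funext => n /=; rewrite ts.
Qed.

Lemma orbit_trans v u w : orbit u v -> orbit v w -> orbit u w.
Proof.
move=> [s [bs vu]] [t [bt wv]]; exists (s \o t).
by split; [exact: bij_comp|rewrite wv vu].
Qed.

Lemma orbit_isometry u v v' : orbit v v' ->
  exists2 u', orbit u u' & `|u' - v'| = `|u - v|.
Proof.
move=> [s [bs v'E]].
exists (L2 (l2perm_subproof u bs)); first by exists s.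
rewrite /Num.norm/= /l2norm; congr (Num.sqrt (fine _)).
by rewrite /= v'E -[RHS](sqsum_perm _ bs).
Qed.

Definition orbit_dists u v : set R :=
  [set `|p.1 - p.2| | p in orbit u `*` orbit v].

Lemma orbit_dists_has_inf u v : has_inf (orbit_dists u v).
Proof.
split; last by exists 0 => _ [p _ <-].
exists `|u - v|, (u, v) => //; split; exact: orbit_refl.
Qed.

(* The quotient distance in terms of representatives. *)
Definition orbit_dist u v : R := inf (orbit_dists u v).

Lemma orbit_dist_le u v p q : orbit u p -> orbit v q ->
  orbit_dist u v <= `|p - q|.
Proof.
move=> up vq; apply: ge_inf; first by have [] := orbit_dists_has_inf u v.
by exists (p, q).
Qed.

Lemma orbit_dist_ge u v (r : R) :
  (forall p q, orbit u p -> orbit v q -> r <= `|p - q|) -> r <= orbit_dist u v.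
Proof.
move=> h; apply: lb_le_inf; first by have [] := orbit_dists_has_inf u v.
by move=> _ [[p q] /= [up vq] <-]; exact: h.
Qed.

Lemma orbit_dist_lt u v (e : R) : orbit_dist u v < e ->
  exists p q, [/\ orbit u p, orbit v q & `|p - q| < e].
Proof.
move=> /(inf_lt (proj1 (orbit_dists_has_inf u v)))[_ [[p q] /= [up vq] <-] pqe].
by exists p, q.
Qed.

Lemma orbit_dist_ge0 u v : 0 <= orbit_dist u v.
Proof. by apply: orbit_dist_ge => p q _ _; exact: normr_ge0. Qed.

Lemma orbit_distuu u : orbit_dist u u = 0.
Proof.
apply/eqP; rewrite eq_le orbit_dist_ge0 andbT -[leRHS](@normr0 _ l2) -(subrr u).
by apply: orbit_dist_le; exact: orbit_refl.
Qed.

Lemma orbit_dist_sym u v : orbit_dist u v = orbit_dist v u.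
Proof.
by apply/eqP; rewrite eq_le; apply/andP; split;
  apply: orbit_dist_ge => p q vp uq; rewrite distrC; exact: orbit_dist_le.
Qed.

Lemma orbit_dist_triangle v u w :
  orbit_dist u w <= orbit_dist u v + orbit_dist v w.
Proof.
rewrite -lerBlDr; apply: orbit_dist_ge => p q up vq.
rewrite lerBlDr addrC -lerBlDr; apply: orbit_dist_ge => q' r vq' wr.
have [p' pp' <-] := orbit_isometry p (orbit_trans (orbit_sym vq) vq').
rewrite lerBlDr addrC; apply: (le_trans _ (ler_distD q' _ _)).
by apply: orbit_dist_le => //; exact: orbit_trans pp'.
Qed.

Lemma orbit_dist_eq0 u v :
  orbit_dist u v = 0 <-> closure (orbit u) = closure (orbit v).
Proof.
have closureP (x y : l2) : closure (orbit x) y <-> orbit_dist x y = 0.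
  split=> [xy|xy].
    apply/eqP; rewrite eq_le orbit_dist_ge0 andbT; apply/ler_addgt0Pl => e e0.
    have [p [xp]] := xy _ (nbhsx_ballx y e e0).
    rewrite -ball_normE /= distrC addr0 => /ltW; apply: le_trans.
    by apply: orbit_dist_le => //; exact: orbit_refl.
  move=> B /nbhs_ballP[e /= e0 eB].
  have [|p [q [xp yq pqe]]] := @orbit_dist_lt x y e; first by rewrite xy.
  have [p' pp' p'y] := orbit_isometry p (orbit_sym yq).
  exists p'; split; first exact: orbit_trans pp'.
  by apply: eB; rewrite -ball_normE /= distrC p'y.
split=> [uv|uv].
  have sub (x y : l2) : orbit_dist x y = 0 -> closure (orbit x) `<=` closure (orbit y).
    move=> xy z /closureP xz; apply/closureP/eqP.
    rewrite eq_le orbit_dist_ge0 andbT.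
    by rewrite (le_trans (orbit_dist_triangle x y z))// xz orbit_dist_sym xy addr0.
  by apply/seteqP; split; apply: sub => //; rewrite orbit_dist_sym.
by apply/closureP; rewrite uv; apply/closureP; exact: orbit_distuu.
Qed.

(* The points of l^2(N; R^d) // S_oo: closures of orbits. *)
Record l2quot := L2quot {
  orbit_closure :> set l2 ;
  _ : exists u, orbit_closure = closure (orbit u) }.

Definition l2class u : l2quot := L2quot (ex_intro _ u erefl).

Lemma l2quot_repr (a : l2quot) : {u : l2 | a = l2class u}.
Proof.
apply: cid; case: a => A [u Au]; exists u; move: (ex_intro _ u Au) => /=.
by rewrite Au => AE; congr L2quot; exact: Prop_irrelevance.
Qed.

Lemma l2class_eq u v : l2class u = l2class v <-> orbit_dist u v = 0.
Proof.
split=> [[]/orbit_dist_eq0//|/orbit_dist_eq0 uv].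
rewrite /l2class; move: (ex_intro _ u _) => /=; rewrite uv => p.
by congr L2quot; exact: Prop_irrelevance.
Qed.

HB.instance Definition _ := gen_eqMixin l2quot.
HB.instance Definition _ := gen_choiceMixin l2quot.

(* The value does not depend on the representatives chosen here: see
   mdist_l2class. *)
Definition l2quot_dist (a b : l2quot) : R :=
  orbit_dist (projT1 (l2quot_repr a)) (projT1 (l2quot_repr b)).

Lemma l2quot_dist_class u v : l2quot_dist (l2class u) (l2class v) = orbit_dist u v.
Proof.
rewrite /l2quot_dist.
case: (l2quot_repr (l2class u)) => u' /= /l2class_eq uu'.
case: (l2quot_repr (l2class v)) => v' /= /l2class_eq vv'.
apply/eqP; rewrite eq_le; apply/andP; split.
  rewrite (le_trans (orbit_dist_triangle u _ _))// orbit_dist_sym uu' add0r.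
  by rewrite (le_trans (orbit_dist_triangle v _ _))// vv' addr0.
rewrite (le_trans (orbit_dist_triangle u' _ _))// uu' add0r.
by rewrite (le_trans (orbit_dist_triangle v' _ _))// [_ v' v]orbit_dist_sym vv' addr0.
Qed.

Let distxx a : l2quot_dist a a = 0.
Proof. exact: orbit_distuu. Qed.

Let dist_positivity a b : l2quot_dist a b = 0 -> a = b.
Proof.
rewrite /l2quot_dist; case: (l2quot_repr a) => u au; case: (l2quot_repr b) => v bv.
by move=> /= /l2class_eq; rewrite -au -bv.
Qed.

Let dist_sym a b : l2quot_dist a b = l2quot_dist b a.
Proof. exact: orbit_dist_sym. Qed.

Let dist_triangle b a c :
  l2quot_dist a c <= l2quot_dist a b + l2quot_dist b c.
Proof. exact: orbit_dist_triangle. Qed.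

HB.instance Definition _ :=
  isMetric.Build R l2quot distxx dist_positivity dist_sym dist_triangle.

Lemma mdist_l2class u v : mdist (l2class u) (l2class v) =
  inf [set `|p.1 - p.2| | p in orbit u `*` orbit v].
Proof. exact: l2quot_dist_class. Qed.

End L2.

Arguments l2 : clear implicits.
Arguments l2quot : clear implicits.

(* Main.v *)
(* For a finite set P of points and x in P, let w_x list the points of P with x
   repeated once more. The squared distance between the orbits of w_x and w_y is
   the least value of sum_i |p_i - p_(i+1)|^2 over the chains in P from x to y:
   each point of the chain moves to its successor. Since short steps are cheap,
   subdividing the edges of a graph drawn in R^3 without crossings shows that
   the square root of the shortest-path metric of any finite graph embeds, up to
   scaling and a constant factor, in the quotient; the factor does not depend on
   the graph.

   We use the rank metric on the r x r matrices over F_2, the graph metric in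
   which neighbours differ by a matrix q p of rank at most one. Its average is
   at least r / 2, because rank a + rank (1 - a) >= r. By Fourier analysis on
   F_2^(r x r), the average of |F x - F y|^2 over all pairs is at most twice its
   average over the pairs (x, x + q p), for every Hilbert-valued F. A map of
   distortion c therefore satisfies r <= 12 c^2, which fails for r large. *)
Require Import Defs.
From mathcomp Require Import all_boot all_order all_algebra.
From mathcomp Require Import all_classical all_reals all_analysis.
From mathcomp Require Import ring lra zify.
Set Implicit Arguments.
Unset Strict Implicit.
Unset Printing Implicit Defensive.
Import Order.TTheory GRing.Theory Num.Theory.
Import numFieldNormedType.Exports.
Local Open Scope classical_set_scope.
Local Open Scope ring_scope.

(** * The rank metric on matrices over F_2 *)

Section Signs.
Context {R : realType}.

Definition sgn2 (b : 'F_2) : R := if b == 0 then 1 else -1.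

Lemma F2_cases (b : 'F_2) : b = 0 \/ b = 1.
Proof. by case: b => [[|[|//]] i]; [left|right]; apply: val_inj. Qed.

Lemma F2_neq0 (b : 'F_2) : b != 0 -> b = 1.
Proof. by case: (F2_cases b) => ->; rewrite ?eqxx. Qed.

Lemma sgn2D (a b : 'F_2) : sgn2 (a + b) = sgn2 a * sgn2 b.
Proof.
rewrite /sgn2; case: (F2_cases a) => ->; case: (F2_cases b) => ->;
  by rewrite ?(addr0, add0r, eqxx, oner_eq0, mulr1, mul1r) // mulrN1 opprK.
Qed.

(** Translating by [v0] flips the sign of every term, so the sum is its own negative. *)
Lemma sum_sgn2 (V : finZmodType) (phi : V -> 'F_2) (v0 : V) :
  {morph phi : a b / a + b} -> phi v0 != 0 -> \sum_v sgn2 (phi v) = 0.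
Proof.
move=> phiD /F2_neq0 v01; set S := \sum_v _.
have : S = - S.
  rewrite {1}/S (reindex_inj (addrI v0)) /= -sumrN; apply: eq_bigr => v _.
  by rewrite phiD sgn2D v01 {1}/sgn2 oner_eq0 mulN1r.
by move: S => S S0; lra.
Qed.

Lemma sgn2_sqrB (b : 'F_2) : (sgn2 b - 1) ^+ 2 = 2 * (1 - sgn2 b).
Proof. by rewrite /sgn2; case: ifP => _; ring. Qed.

End Signs.

Section Rank.
Context {R : realType} (r : nat).
Notation T := 'M['F_2]_r.
Local Notation chi z x := (@sgn2 R (\tr (z *m x))).

Lemma chiD (z x y : T) : chi z (x + y) = chi z x * chi z y.
Proof. by rewrite mulmxDr mxtraceD sgn2D. Qed.

(** The trace pairing is nondegenerate: a nonzero entry [x i j] is detected by [delta_mx j i]. *)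
Lemma chi_orthogonal (x : T) : \sum_(z : T) chi z x = #|T|%:R * (x == 0)%:R.
Proof.
have [->|x0] := eqVneq x 0.
  rewrite mulr1 -sum1_card natr_sum; apply: eq_bigr => z _.
  by rewrite mulmx0 mxtrace0 /sgn2 eqxx.
rewrite mulr0; have [[i j] xij] : exists p : 'I_r * 'I_r, x p.1 p.2 != 0.
  apply/existsP; apply: contraNT x0 => /existsPn x0.
  by apply/eqP/matrixP => i j; rewrite mxE; have /negPn/eqP := x0 (i, j).
apply: (@sum_sgn2 R _ (fun z => \tr (z *m x)) (delta_mx j i)).
  by move=> a b; rewrite mulmxDl mxtraceD.
rewrite /mxtrace (bigD1 j) //= big1 ?addr0 => [|k kj]; last first.
  by rewrite mxE big1 // => l _; rewrite mxE (negPf kj) mul0r.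
rewrite mxE (bigD1 i) //= big1 ?addr0 => [|l li].
  by rewrite mxE !eqxx mul1r.
by rewrite mxE (negPf li) andbF mul0r.
Qed.


Lemma chi_sum_shift (z : T) :
  \sum_(a : T) (chi z a - 1) ^+ 2 = 2 * #|T|%:R * (z != 0)%:R.
Proof.
have -> : \sum_(a : T) (chi z a - 1) ^+ 2 = \sum_(a : T) 2 * (1 - chi a z).
  by apply: eq_bigr => a _; rewrite sgn2_sqrB mxtrace_mulC.
rewrite -mulr_sumr sumrB chi_orthogonal sumr_const -mulrA; congr (2 * _).
by case: (z == 0); rewrite ?mulr1 ?mulr0 ?subrr ?subr0.
Qed.

(** Translation by a column outside the kernel of [z] injects the kernel into its complement. *)
Lemma card_image_neq0_ge (z : T) : z != 0 ->
  (#|{: 'cV['F_2]_r}| <= 2 * #|[pred q : 'cV['F_2]_r | (z *m q != 0)%R]|)%N.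
Proof.
move=> z0; set P := [pred q | _].
have [q0 zq0] : exists q0 : 'cV['F_2]_r, z *m q0 != 0.
  apply/existsP; apply: contraNT z0 => /existsPn zq.
  apply/eqP/matrixP => i j; have /negPn/eqP := zq (delta_mx j 0).
  by rewrite -colE => /colP/(_ i); rewrite !mxE.
rewrite -(cardC P) mul2n -addnn leq_add2l -(card_imset _ (addrI q0)).
apply/subset_leq_card/fintype.subsetP => _ /imsetP[q /negPn/eqP zq ->].
by rewrite inE mulmxDr zq addr0.
Qed.

(** For fixed [q], [chi z (q *m p)] is a character in [p], trivial exactly when [z *m q = 0]; by
    [card_image_neq0_ge] it is nontrivial for at least half of the columns. *)
Lemma chi_sum_rank1 (z : T) :
  #|{: 'cV['F_2]_r}|%:R * #|{: 'rV['F_2]_r}|%:R * (z != 0)%:R <=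
  \sum_(q : 'cV['F_2]_r) \sum_(p : 'rV['F_2]_r) (chi z (q *m p) - 1) ^+ 2.
Proof.
have [->|z0] := eqVneq z 0.
  by rewrite mulr0; do 2!apply: sumr_ge0 => ? _; exact: sqr_ge0.
rewrite mulr1.
have row_sum (q : 'cV['F_2]_r) :
    \sum_(p : 'rV['F_2]_r) (chi z (q *m p) - 1) ^+ 2 =
    2 * #|{: 'rV['F_2]_r}|%:R * (z *m q != 0)%:R.
  under eq_bigr do rewrite sgn2_sqrB mulmxA mxtrace_mulC.
  rewrite -mulr_sumr sumrB sumr_const -mulrA; congr (2 * _).
  have [->|zq0] /= := eqVneq (z *m q) 0.
    rewrite mulr0; under eq_bigr do rewrite mulmx0 mxtrace0 /sgn2 eqxx.
    by rewrite sumr_const subrr.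
  have [i zqi] : exists i, (z *m q) i 0 != 0.
    apply/existsP; apply: contraNT zq0 => /existsPn zq0.
    by apply/eqP/colP => i; rewrite [RHS]mxE; have /negPn/eqP := zq0 i.
  rewrite (@sum_sgn2 R _ (fun p : 'rV['F_2]_r => \tr (p *m (z *m q)))
    (delta_mx 0 i)) ?subr0 ?mulr1 //.
    by move=> a b; rewrite mulmxDl mxtraceD.
  by rewrite -rowE /mxtrace big_ord1 mxE.
rewrite (eq_bigr _ (fun q _ => row_sum q)) -mulr_sumr.
rewrite [leLHS]mulrC [2 * _]mulrC -mulrA ler_wpM2l ?ler0n //.
rewrite -natr_sum -natrM ler_nat.
apply: leq_trans (card_image_neq0_ge z0) _.
rewrite leq_pmul2l // -sum1_card big_mkcond /=.
by apply: leq_sum => q _; rewrite inE; case: eqP.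
Qed.

(** * Parseval identity and Poincaré inequality *)

Section Fourier.
Context (H : lmodType R) (dot : {dot H for idfun}).

Definition fourier (f : T -> H) (z : T) : H := \sum_x chi z x *: f x.

Lemma parseval (f : T -> H) :
  \sum_z dot (fourier f z) (fourier f z) = #|T|%:R * \sum_x dot (f x) (f x).
Proof.
have dotE z : dot (fourier f z) (fourier f z) =
    \sum_x \sum_y chi z (x + y) * dot (f x) (f y).
  rewrite /fourier linear_sumlz /=; apply: eq_bigr => x _.
  rewrite linear_sumr /=; apply: eq_bigr => y _.
  by rewrite linearZl_LR linearZr_LR /= chiD mulrA.
rewrite (eq_bigr _ (fun z _ => dotE z)) exchange_big mulr_sumr /=.
(* In characteristic 2 the isolated term [y = - x] is the diagonal one. *)
apply: eq_bigr => x _; rewrite exchange_big /= (bigD1 (- x)) //=.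
have ortho y : \sum_z chi z (x + y) * dot (f x) (f y) =
    #|T|%:R * (x + y == 0)%:R * dot (f x) (f y).
  by rewrite -chi_orthogonal mulr_suml.
rewrite [X in _ + X]big1 ?addr0 => [|y yx]; rewrite ortho.
  have -> : - x = x.
    by apply/matrixP => i j; rewrite mxE; case: (F2_cases (x i j)) => ->; exact: val_inj.
  have -> : x + x = 0.
    by apply/matrixP => i j; rewrite !mxE; case: (F2_cases (x i j)) => ->; exact: val_inj.
  by rewrite eqxx mulr1.
by rewrite addrC addr_eq0 (negPf yx) mulr0 mul0r.
Qed.

Lemma fourier_shift (f : T -> H) (a z : T) :
  fourier (fun x => f (x + a) - f x) z = (chi z a - 1) *: fourier f z.
Proof.
rewrite /fourier scalerBl scale1r.
under eq_bigr do rewrite scalerBr.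
rewrite sumrB; congr (_ - _).
rewrite [in RHS](reindex_inj (addIr a)) /= scaler_sumr.
apply: eq_bigr => x _; rewrite chiD scalerA mulrCA -expr2.
suff -> : chi z a ^+ 2 = 1 by rewrite mulr1.
by rewrite /sgn2; case: ifP; rewrite ?sqrrN expr1n.
Qed.

Lemma parseval_shift (f : T -> H) (a : T) :
  #|T|%:R * \sum_x dot (f (x + a) - f x) (f (x + a) - f x) =
  \sum_z (chi z a - 1) ^+ 2 * dot (fourier f z) (fourier f z).
Proof.
rewrite -(parseval (fun x => f (x + a) - f x)); apply: eq_bigr => z _.
by rewrite fourier_shift linearZl_LR linearZr_LR /= mulrA -expr2.
Qed.

(* The spectral gap comes from chi_sum_rank1: a nontrivial character takes the
   value -1 on at least a quarter of the pairs (q, p). *)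
Lemma rank_poincare (f : T -> H) :
  #|{: 'cV['F_2]_r}|%:R * #|{: 'rV['F_2]_r}|%:R *
  \sum_a \sum_x dot (f (x + a) - f x) (f (x + a) - f x) <=
  2 * #|T|%:R * \sum_(q : 'cV['F_2]_r) \sum_(p : 'rV['F_2]_r)
     \sum_x dot (f (x + q *m p) - f x) (f (x + q *m p) - f x).
Proof.
have T0 : 0 < #|T|%:R :> R by rewrite ltr0n; apply/card_gt0P; exists 0.
rewrite -(ler_pM2l T0) mulrCA mulr_sumr.
rewrite (eq_bigr _ (fun a _ => parseval_shift f a)) exchange_big /=.
rewrite [leRHS]mulrCA [in leRHS]mulr_sumr.
have -> : \sum_(q : 'cV['F_2]_r) #|T|%:R * (\sum_(p : 'rV['F_2]_r)
     \sum_x dot (f (x + q *m p) - f x) (f (x + q *m p) - f x)) =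
  \sum_z (\sum_(q : 'cV['F_2]_r) \sum_(p : 'rV['F_2]_r)
     (chi z (q *m p) - 1) ^+ 2) * dot (fourier f z) (fourier f z).
  under [RHS]eq_bigr do rewrite mulr_suml.
  rewrite [RHS]exchange_big /=; apply: eq_bigr => q _.
  under [RHS]eq_bigr do rewrite mulr_suml.
  rewrite [RHS]exchange_big mulr_sumr /=; apply: eq_bigr => p _.
  exact: parseval_shift.
rewrite !mulr_sumr; apply: ler_sum => z _.
rewrite -mulr_suml chi_sum_shift !mulrA ler_wpM2r //.
  have [->|fz] := eqVneq (fourier f z) 0; first by rewrite linear0l.
  exact/ltW/neq0_dnorm_gt0.
apply: le_trans (ler_wpM2l _ (chi_sum_rank1 z)); last by rewrite mulr_ge0.
by rewrite le_eqVlt; apply/orP; left; apply/eqP; ring.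
Qed.

End Fourier.

Lemma sum_rank_ge :
  (r * #|T| <= 2 * \sum_(a : T) \rank a)%N.
Proof.
(* One of the two copies of the sum is reindexed by the involution sending [a] to [1%:M - a]. *)
rewrite mul2n -addnn {2}(reindex_inj (inj_comp (addrI 1%:M) oppr_inj)) /=.
rewrite -big_split /= mulnC -sum_nat_const.
apply: leq_sum => a _; rewrite -{1}(mxrank1 'F_2 r) -[X in \rank X](subrK a).
by rewrite addrC; apply: leq_trans (mxrank_add _ _) _.
Qed.

End Rank.

(** * Orbit distances of finite configurations *)

Section FiniteConfigurations.
Context {R : realType} {d : nat}.
Local Notation V := 'rV[R]_d.
Implicit Types s t : seq V.

Lemma sqsum_nth s : sqsum (nth 0 s) = (\sum_(v <- s) enorm v ^+ 2)%:E.
Proof.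
rewrite /sqsum (nneseries_split 0 (size s)); last first.
  by move=> k _; rewrite lee_fin sqr_ge0.
rewrite add0n [X in (_ + X)%E]eseries0 ?adde0; last first.
  move=> i si _; rewrite nth_default // enormE big1 // => j _.
  by rewrite mxE expr0n.
by rewrite sumEFin -(big_nth 0 xpredT (fun v => enorm v ^+ 2)).
Qed.

Lemma square_summable_nth s : nth 0 s \in square_summable.
Proof. by rewrite square_summableE sqsum_nth ltry. Qed.

Definition l2seq s : l2 R d := L2 (square_summable_nth s).

Lemma l2seq_dist s t : size s = size t ->
  `|l2seq s - l2seq t| ^+ 2 = \sum_(p <- zip s t) enorm (p.1 - p.2) ^+ 2.
Proof.
move=> st; apply/EFin_inj; rewrite -(sqsumE (valP (l2seq s - l2seq t))).
rewrite -(big_map (fun p => p.1 - p.2) xpredT (fun v => enorm v ^+ 2)).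
rewrite -sqsum_nth; congr (sqsum _); apply/funext => n /=.
have [ns|ns] := ltnP n (size s).
  by rewrite (nth_map (0, 0)) ?size_zip -?st ?minnn // nth_zip.
rewrite [RHS]nth_default ?size_map ?size_zip -?st ?minnn //.
by rewrite [LHS](_ : _ = nth 0 s n - nth 0 t n) // !nth_default -?st ?subrr.
Qed.

Lemma orbit_l2seq s t : perm_eq t s -> Defs.orbit (l2seq s) (l2seq t).
Proof.
move=> /(perm_iotaP 0)[Is]; set K := size s => IsP tE.
have sI : size Is = K by rewrite (perm_size IsP) size_iota.
have uI : uniq Is by rewrite (perm_uniq IsP) iota_uniq.
have memI n : (n \in Is) = (n < K)%N by rewrite (perm_mem IsP) mem_iota.
(* The finite permutation is extended by the identity beyond [K]; [sh] is its inverse. *)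
pose sg n := if (n < K)%N then nth 0%N Is n else n.
pose sh n := if (n < K)%N then index n Is else n.
exists sg; split.
  exists sh => n; rewrite /sg /sh.
    have [nK|nK] := ltnP n K; last by rewrite ltnNge nK.
    by rewrite -memI mem_nth ?sI // index_uniq ?sI.
  have [nK|nK] := ltnP n K; last by rewrite ltnNge nK.
  have -> : (index n Is < K)%N by rewrite -sI index_mem memI.
  by rewrite nth_index ?memI.
apply/funext => n /=; rewrite tE /sg; case: ltnP => nK.
  by rewrite (nth_map 0%N) // sI.
by rewrite !nth_default // size_map sI.
Qed.

End FiniteConfigurations.

(** * Chains of points and transport bounds *)

Section Transport.
Context {R : realType} {d : nat} (J : finType) (pos : J -> 'rV[R]_d).

Definition cost (a b : J) : R := enorm (pos a - pos b) ^+ 2.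

Fixpoint chain_cost (a : J) (l : seq J) : R :=
  if l is b :: l' then cost a b + chain_cost b l' else 0.

Definition reach (a b : J) (e : R) : Prop :=
  exists2 l, last a l = b & chain_cost a l <= e.

Definition config (a : J) : l2 R d := l2seq [seq pos b | b <- a :: enum J].

Lemma cost_ge0 a b : 0 <= cost a b.
Proof. exact: sqr_ge0. Qed.

Lemma costC a b : cost a b = cost b a.
Proof. by rewrite /cost !enormE; apply: eq_bigr => i _; rewrite !mxE -sqrrN opprB. Qed.

Lemma costxx a : cost a a = 0.
Proof. by rewrite /cost enormE big1 // => i _; rewrite subrr mxE expr0n. Qed.

Lemma chain_cost_cat a l l' :
  chain_cost a (l ++ l') = chain_cost a l + chain_cost (last a l) l'.
Proof. by elim: l a => [|b l IH] a /=; rewrite ?add0r // IH addrA. Qed.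

Lemma chain_cost_ge0 a l : 0 <= chain_cost a l.
Proof. by elim: l a => //= b l IH a; rewrite addr_ge0 ?cost_ge0. Qed.

(** Loop erasure: cutting out a loop discards nonnegative costs. The start [a] may recur in [l'], in
    accordance with [config a] containing it twice. *)
Lemma chain_cost_uniq a l :
  exists l', [/\ last a l' = last a l, uniq l' & chain_cost a l' <= chain_cost a l].
Proof.
elim: l a => [|b l IH] a; first by exists [::].
have [l' [ll' ul' cl']] := IH b.
have [bl'|bl'] := boolP (b \in l'); last first.
  by exists (b :: l'); rewrite /= bl' ul' lerD2l.
case/splitPr: bl' ll' ul' cl' => l1 l2 ll' ul' cl'.
exists (b :: l2); split; first by rewrite /= -ll' last_cat.
  by move: ul'; rewrite cat_uniq => /and3P[].
rewrite /= lerD2l (le_trans _ cl') // chain_cost_cat /= addrA.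
by rewrite lerDr addr_ge0 ?chain_cost_ge0 ?cost_ge0.
Qed.

(* Every point of the chain moves to its successor, so the configuration with
   the first point doubled becomes the one with the last point doubled. *)
Lemma orbit_dist_chain a l :
  orbit_dist (config a) (config (last a l)) ^+ 2 <= chain_cost a l.
Proof.
have [l' [<- ul' cl']] := chain_cost_uniq a l; apply: le_trans cl'.
(* The points in [Q] are those off [l]; they stay in place. As [l] has no repetitions, [l ++ Q]
   lists each point of [J] once. *)
move: l' ul' => {}l ul; pose Q := [seq b <- enum J | b \notin l].
have lQ : perm_eq (l ++ Q) (enum J).
  apply: uniq_perm; rewrite ?enum_uniq //.
    rewrite cat_uniq ul filter_uniq ?enum_uniq // andbT /=.
    by apply/hasPn => b; rewrite mem_filter => /andP[].
  by move=> b; rewrite mem_cat mem_filter mem_enum andbT orbN.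
have sz : size (a :: l ++ Q) = size (l ++ last a l :: Q).
  by rewrite /= !size_cat /= addnS.
have -> : chain_cost a l = `|l2seq [seq pos b | b <- a :: l ++ Q] -
    l2seq [seq pos b | b <- l ++ last a l :: Q]| ^+ 2.
  rewrite l2seq_dist ?size_map //; move: Q {ul lQ sz} => Q.
  elim: l a => [|b l IH] a /=; last by rewrite big_cons IH.
  rewrite big_cons /= -/(cost a a) costxx add0r.
  elim: Q => [|b Q IH]; first by rewrite big_nil.
  by rewrite /= big_cons -IH addr0 /= -/(cost b b) costxx.
rewrite ler_sqr ?nnegrE ?orbit_dist_ge0 //.
apply: orbit_dist_le; apply: orbit_l2seq; apply: perm_map.
  by rewrite perm_cons.
by rewrite -cat1s perm_catCA /= perm_cons.
Qed.

Lemma orbit_dist_reach a b e :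
  reach a b e -> orbit_dist (config a) (config b) ^+ 2 <= e.
Proof. by case=> l <-; apply: le_trans; exact: orbit_dist_chain. Qed.

Lemma reach_trans b a c e e' : reach a b e -> reach b c e' -> reach a c (e + e').
Proof.
move=> [l <- le_e] [l' <- le_e']; exists (l ++ l'); first by rewrite last_cat.
by rewrite chain_cost_cat lerD.
Qed.

Lemma reach_cost a b e : cost a b <= e -> reach a b e.
Proof. by move=> abe; exists [:: b]; rewrite //= addr0. Qed.

Lemma reach_walk (p : nat -> J) (e : R) (K i j : nat) :
  (forall k, cost (p k) (p k.+1) <= e) -> (i <= K)%N -> (j <= K)%N ->
  reach (p i) (p j) (K%:R * e).
Proof.
move=> pe iK jK.
have e0 : 0 <= e by apply: le_trans (pe 0%N); exact: cost_ge0.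
have walk n k : reach (p k) (p (n + k)%N) (n%:R * e) /\
    reach (p (n + k)%N) (p k) (n%:R * e).
  elim: n => [|n [IH1 IH2]]; first by rewrite mul0r add0n; split; exists [::].
  rewrite addSn -natr1 mulrDl mul1r; split.
    by apply: reach_trans IH1 _; apply: reach_cost.
  by rewrite addrC; apply: reach_trans IH2; apply: reach_cost; rewrite costC.
have [ij|/ltnW ij] := leqP i j; rewrite -(subnK ij).
  have [[l <- le_l] _] := walk (j - i)%N i; exists l => //.
  by apply: le_trans le_l _; rewrite ler_wpM2r // ler_nat; lia.
have [_ [l <- le_l]] := walk (i - j)%N j; exists l => //.
by apply: le_trans le_l _; rewrite ler_wpM2r // ler_nat; lia.
Qed.

(* Kantorovich duality, easy direction; the zeros of a sequence act as a
   reservoir of mass at the origin, hence the condition phi b <= |pos b|^2. *)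
Lemma orbit_dist_potential (phi : J -> R) a b :
  (forall j, 0 <= phi j <= enorm (pos j) ^+ 2) ->
  (forall j k, phi j - phi k <= cost j k) ->
  phi a - phi b <= orbit_dist (config a) (config b) ^+ 2.
Proof.
move=> phi_bnd phi_lip.
have [ab|ab] := leP (phi a - phi b) 0; first exact: le_trans (sqr_ge0 _).
rewrite -[leLHS]sqr_sqrtr ?(ltW ab) // ler_sqr ?nnegrE ?sqrtr_ge0 ?orbit_dist_ge0 //.
apply: orbit_dist_ge => p q [s [bs ps]] [t [bt qt]].
rewrite -(@ger0_norm _ `|p - q|) // -sqrtr_sqr ler_wsqrtr //.
pose Phi c n := nth 0 [seq phi j | j <- c :: enum J] n.
have Phi_ge0 c n : 0 <= Phi c n.
  have [nc|nc] := ltnP n (size (c :: enum J)); last by rewrite /Phi nth_default ?size_map.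
  by rewrite /Phi (nth_map c) //; case/andP: (phi_bnd (nth c (c :: enum J) n)).
pose w c n := nth 0 [seq pos j | j <- c :: enum J] n.
(* Past the listed points both the potential and the position are 0. A listed point matched with
   such a zero is handled by the bound of [phi] by the squared norm. *)
have Phi_lip m n : Phi a m <= Phi b n + enorm (w a m - w b n) ^+ 2.
  rewrite /w /Phi.
  have [ma|ma] := ltnP m (size (a :: enum J)); last first.
    by rewrite nth_default ?size_map // addr_ge0 ?sqr_ge0 ?Phi_ge0.
  rewrite !(nth_map a _ _ ma).
  set j := nth a _ m.
  have [nb|nb] := ltnP n (size (b :: enum J)).
    by rewrite !(nth_map b _ _ nb) -lerBlDl; exact: phi_lip.
  rewrite !nth_default ?size_map // add0r subr0.
  by case/andP: (phi_bnd j).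
(* A series of nonnegative terms is invariant under the bijection [u]. The part common to [a] and
   [b] cancels at the end and leaves [phi a - phi b]. *)
have Phi_sum c (u : nat -> nat) : bijective u ->
    (\sum_(0 <= n <oo) (Phi c (u n))%:E)%E = (phi c + \sum_(j in J) phi j)%:E.
  move=> bu; rewrite nneseries_esumT; last by move=> n; rewrite lee_fin.
  rewrite -(@reindex_esum _ _ _ setT setT u (fun n => (Phi c n)%:E)); last first.
    by rewrite setTT_bijective.
  rewrite -nneseries_esumT; last by move=> n; rewrite lee_fin.
  rewrite (nneseries_split 0 (size (c :: enum J))); last by move=> k _; rewrite lee_fin.
  rewrite add0n [X in (_ + X)%E]eseries0 ?adde0; last first.
    by move=> i si _; rewrite /Phi nth_default ?size_map.
  rewrite sumEFin -(size_map phi (c :: enum J)).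
  by rewrite -(big_nth 0 xpredT id) big_map big_cons big_enum.
have: (\sum_(0 <= n <oo) (Phi a (s n))%:E <= \sum_(0 <= n <oo)
    ((Phi b (t n))%:E + (enorm ((p - q) n) ^+ 2)%:E))%E.
  apply: lee_nneseries => n _; first by rewrite lee_fin.
  rewrite -EFinD lee_fin.
  have -> : (p - q) n = w a (s n) - w b (t n).
    by rewrite [LHS](_ : _ = val p n - val q n) // ps qt.
  exact: Phi_lip.
rewrite nneseriesD; try by move=> *; rewrite lee_fin ?sqr_ge0.
rewrite !Phi_sum // -/(sqsum (val (p - q))) (sqsumE (valP (p - q))).
by rewrite -EFinD lee_fin -/(l2norm (p - q)) addrAC lerD2r -lerBlDl.
Qed.

End Transport.

(** * Drawing a graph in space *)

Section Scaffold.
Context {R : realType} {d : nat} (d_ge3 : (3 <= d)%N).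

Definition vec3 (a b c : R) : 'rV[R]_d := \row_i nth 0 [:: a; b; c] i.

Lemma vec3B (a b c a' b' c' : R) :
  vec3 a b c - vec3 a' b' c' = vec3 (a - a') (b - b') (c - c').
Proof.
apply/rowP => i; rewrite !mxE; case: (i : nat) => [|[|[|k]]] //=.
by rewrite nth_nil subr0.
Qed.

Lemma enorm_vec3 (a b c : R) :
  enorm (vec3 a b c) ^+ 2 = a ^+ 2 + b ^+ 2 + c ^+ 2.
Proof.
rewrite enormE (eq_bigr (fun i : 'I_d => nth 0 [:: a; b; c] i ^+ 2)); last first.
  by move=> i _; rewrite mxE.
rewrite -(big_mkord xpredT (fun i => nth 0 [:: a; b; c] i ^+ 2)).
(* Here [d_ge3] enters: the three coordinates fit into the row. *)
rewrite (big_cat_nat (n := 3)) //= [X in _ + X]big_nat.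
rewrite [X in _ + X]big1 ?addr0 => [|i /andP[i3 _]]; last first.
  by rewrite nth_default // expr0n.
by rewrite !big_nat_recr //= big_nil add0r.
Qed.

Context (T : finType) (e : rel T) (N : nat).
Context (e_refl : reflexive e) (N_gt0 : (0 < N)%N).

(** Poles and bars have [K] steps of length [1 / M], so they extend to [#|T|], the largest [idx].
    Traversing a whole one costs at most [K / M ^ 2 = 1 / (2 * N)], less than the cost [1 / N] of a
    post. *)
Local Notation M := (2 * (#|T| * N))%N.
Local Notation K := (#|T| * M)%N.

(* A vertical pole for each vertex x in the plane of height 0 of the second
   coordinate, a horizontal bar for each vertex y in the plane of height 1,
   and a post joining the pole of x to the bar of y whenever x and y are
   adjacent. *)
Definition scaffold : finType :=
  (T * 'I_K.+1 + T * 'I_K.+1 + {p : T * T | e p.1 p.2} * 'I_N.+1)%type.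

(** Counting from 1 keeps poles and posts at distance at least 1 from the origin, as [pos_far]
    requires. *)
Definition idx (x : T) : R := (enum_rank x).+1%:R.

Definition pos (s : scaffold) : 'rV[R]_d :=
  match s with
  | inl (inl (x, k)) => vec3 (idx x) 0 (k%:R / M%:R)
  | inl (inr (y, k)) => vec3 (k%:R / M%:R) 1 (idx y)
  | inr (p, i) => vec3 (idx (val p).1) (i%:R / N%:R) (idx (val p).2)
  end.

(** All variation takes place on the posts, linearly; the division by [N] matches the cost [1 / N]
    of a post. *)
Definition potential (g : T -> R) (s : scaffold) : R :=
  match s with
  | inl (inl (x, _)) | inl (inr (x, _)) => g x / N%:R
  | inr (p, i) =>
    (g (val p).1 + (g (val p).2 - g (val p).1) * (i%:R / N%:R)) / N%:R
  end.

(** Clamping the index yields walks over all naturals that stand still past their end, the form that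
    [reach_walk] takes. *)
Definition pole (x : T) (k : nat) : scaffold := inl (inl (x, inord (minn k K))).
Definition bar (y : T) (k : nat) : scaffold := inl (inr (y, inord (minn k K))).
Definition post (p : {p : T * T | e p.1 p.2}) (i : nat) : scaffold :=
  inr (p, inord (minn i N)).

Definition level (x : T) : nat := (enum_rank x).+1 * M.

Let N0 : 0 < N%:R :> R. Proof. by rewrite ltr0n. Qed.

Let M0 (x : T) : 0 < M%:R :> R.
Proof.
rewrite ltr0n !muln_gt0 N_gt0 andbT /=.
by apply/card_gt0P; exists x.
Qed.

Lemma sum_sqr_ge1 (x y z : R) : 1 <= x ^+ 2 \/ 1 <= y ^+ 2 \/ 1 <= z ^+ 2 ->
  1 <= x ^+ 2 + y ^+ 2 + z ^+ 2.
Proof. by have := sqr_ge0 x; have := sqr_ge0 y; have := sqr_ge0 z; lra. Qed.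

Lemma idx_sqrB (x y : T) : x != y -> 1 <= (idx x - idx y) ^+ 2.
Proof.
move=> xy; have : nat_of_ord (enum_rank x) != enum_rank y.
  by apply: contraNneq xy => /val_inj/enum_rank_inj ->.
rewrite /idx -!natr1; case: ltngtP => // lt_xy _; move: lt_xy.
  by rewrite -(ler_nat R) -natr1 => ?; nra.
by rewrite -(ler_nat R) -natr1 => ?; nra.
Qed.

Lemma idx_level (x : T) : (level x)%:R / M%:R = idx x.
Proof. by rewrite /level natrM mulfK // gt_eqF ?(M0 x). Qed.

Lemma level_le (x : T) : (level x <= K)%N.
Proof. by rewrite /level leq_mul2r ltn_ord orbT. Qed.

Lemma cost_vec3 (s t : scaffold) a b c a' b' c' :
  pos s = vec3 a b c -> pos t = vec3 a' b' c' ->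
  cost pos s t = (a - a') ^+ 2 + (b - b') ^+ 2 + (c - c') ^+ 2.
Proof. by rewrite /cost => -> ->; rewrite vec3B enorm_vec3. Qed.

Lemma pos_pole x k : (k <= K)%N -> pos (pole x k) = vec3 (idx x) 0 (k%:R / M%:R).
Proof. by move=> kK; rewrite /= inordK ?ltnS ?geq_minr // (minn_idPl kK). Qed.

Lemma pos_bar y k : (k <= K)%N -> pos (bar y k) = vec3 (k%:R / M%:R) 1 (idx y).
Proof. by move=> kK; rewrite /= inordK ?ltnS ?geq_minr // (minn_idPl kK). Qed.

Lemma pos_post p i : (i <= N)%N ->
  pos (post p i) = vec3 (idx (val p).1) (i%:R / N%:R) (idx (val p).2).
Proof. by move=> iN; rewrite /= inordK ?ltnS ?geq_minr // (minn_idPl iN). Qed.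

Lemma clamp_step (k L : nat) (u : R) : 0 < u ->
  (((minn k L)%:R / u) - ((minn k.+1 L)%:R / u)) ^+ 2 <= (u ^+ 2)^-1.
Proof.
move=> u0; rewrite -mulrBl exprMn exprVn ler_piMl ?invr_ge0 ?sqr_ge0 //.
have [->|->] : minn k.+1 L = minn k L \/ minn k.+1 L = (minn k L).+1 by lia.
  by rewrite subrr expr0n ler01.
by rewrite -natr1; nra.
Qed.

Let K_step (x : T) : K%:R * (M%:R ^+ 2)^-1 = (2 * N%:R)^-1 :> R.
Proof.
have := M0 x; rewrite !natrM => M0'.
have T0 : #|T|%:R != 0 :> R by apply: contraTneq M0' => ->; rewrite mul0r mulr0 ltxx.
by field; rewrite T0 gt_eqF.
Qed.

Lemma reach_pole x i j : (i <= K)%N -> (j <= K)%N ->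
  reach pos (pole x i) (pole x j) (2 * N%:R)^-1.
Proof.
move=> iK jK; rewrite -(K_step x); apply: reach_walk => // k.
rewrite (@cost_vec3 _ _ (idx x) 0 ((minn k K)%:R / M%:R)
  (idx x) 0 ((minn k.+1 K)%:R / M%:R)) /=; try by rewrite inordK // ltnS geq_minr.
by rewrite !subrr expr0n !add0r clamp_step ?(M0 x).
Qed.

Lemma reach_bar y i j : (i <= K)%N -> (j <= K)%N ->
  reach pos (bar y i) (bar y j) (2 * N%:R)^-1.
Proof.
move=> iK jK; rewrite -(K_step y); apply: reach_walk => // k.
rewrite (@cost_vec3 _ _ ((minn k K)%:R / M%:R) 1 (idx y)
  ((minn k.+1 K)%:R / M%:R) 1 (idx y)) /=; try by rewrite inordK // ltnS geq_minr.
by rewrite !subrr expr0n !addr0 clamp_step ?(M0 y).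
Qed.

Lemma reach_post p i j : (i <= N)%N -> (j <= N)%N ->
  reach pos (post p i) (post p j) N%:R^-1.
Proof.
move=> iN jN; have -> : N%:R^-1 = N%:R * (N%:R ^+ 2)^-1 :> R.
  by rewrite expr2 invfM mulVKf ?gt_eqF.
apply: reach_walk => // k.
rewrite (@cost_vec3 _ _ (idx (val p).1) ((minn k N)%:R / N%:R) (idx (val p).2)
  (idx (val p).1) ((minn k.+1 N)%:R / N%:R) (idx (val p).2)) /=;
  try by rewrite inordK // ltnS geq_minr.
by rewrite !subrr expr0n addr0 add0r clamp_step.
Qed.

Lemma reach0 (s t : scaffold) : pos s = pos t -> reach pos s t 0.
Proof. by move=> st; apply: reach_cost; rewrite /cost st -/(cost pos t t) costxx. Qed.

(** This is the point of the pole of [x] where the post of the loop [(x, x)] starts. *)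
Definition rep (x : T) : scaffold := pole x (level x).

(** The route follows the pole of [x] to the post of [(x, y)], this post, the bar of [y], and back
    down the post of the loop [(y, y)]. The zero costs are changes of name between coinciding
    points. *)
Lemma reach_rep x y : e x y -> reach pos (rep x) (rep y) (3 / N%:R).
Proof.
move=> exy; pose p : {p : T * T | e p.1 p.2} := exist _ (x, y) exy.
pose q : {p : T * T | e p.1 p.2} := exist _ (y, y) (e_refl y).
have -> : 3 / N%:R = (2 * N%:R)^-1 + (0 + (N%:R^-1 + (0 + ((2 * N%:R)^-1 +
    (0 + (N%:R^-1 + 0)))))) :> R by field; rewrite gt_eqF.
apply: (reach_trans (reach_pole x (level_le x) (level_le y))).
apply: (@reach_trans _ _ _ _ (post p 0)).
  by apply: reach0; rewrite pos_pole ?level_le // pos_post // idx_level mul0r.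
apply: (reach_trans (reach_post p (leq0n N) (leqnn N))).
apply: (@reach_trans _ _ _ _ (bar y (level x))).
  by apply: reach0; rewrite pos_bar ?level_le // pos_post // idx_level divff ?gt_eqF.
apply: (reach_trans (reach_bar y (level_le x) (level_le y))).
apply: (@reach_trans _ _ _ _ (post q N)).
  by apply: reach0; rewrite pos_bar ?level_le // pos_post // idx_level divff ?gt_eqF.
apply: (reach_trans (reach_post q (leqnn N) (leq0n N))).
by apply: reach0; rewrite pos_pole ?level_le // pos_post // idx_level mul0r.
Qed.

(** * Lower bounds from potentials *)

Section Potential.
Context (g : T -> R).
Context (g_bnd : forall x, 0 <= g x <= N%:R)
  (g_lip : forall x y, e x y -> `|g y - g x| <= 1).

Lemma potential_bnd s : 0 <= potential g s <= 1.
Proof.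
case: s => [[[x k]|[x k]]|[[[x y] /= exy] i]] /=; last 1 first.
  have : (i%:R / N%:R : R) <= 1 by rewrite ler_pdivrMr // mul1r ler_nat -ltnS.
  have : 0 <= (i%:R / N%:R : R) by rewrite divr_ge0.
  move: (i%:R / N%:R) => u u0 u1; rewrite ler_pdivrMr // mul1r.
  have /andP[x0 xN] := g_bnd x; have /andP[y0 yN] := g_bnd y.
  have -> : g x + (g y - g x) * u = g x * (1 - u) + g y * u by ring.
  rewrite divr_ge0 ?addr_ge0 ?mulr_ge0 ?subr_ge0 //=; nra.
all: have /andP[x0 xN] := g_bnd x; by rewrite divr_ge0 //= ler_pdivrMr // mul1r.
Qed.

(** The potential takes values in the unit interval, so only points at distance below 1 need a
    closer look. *)
Lemma potential_far s t : 1 <= cost pos s t ->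
  `|potential g s - potential g t| <= cost pos s t.
Proof.
apply: le_trans; have /andP[? ?] := potential_bnd s.
by have /andP[? ?] := potential_bnd t; rewrite ler_norml; lra.
Qed.

(* A nonzero integer is at most its square in absolute value, so the discrete
   post is Lipschitz for the squared distance although a segment is not. *)
Lemma post_step (v : R) (i j : nat) : `|v| <= 1 ->
  `|v * (i%:R / N%:R - j%:R / N%:R) / N%:R| <= (i%:R / N%:R - j%:R / N%:R) ^+ 2.
Proof.
move=> v1; rewrite -mulrBl.
have uu0 : 0 <= N%:R^-1 * N%:R^-1 :> R by rewrite mulr_ge0.
have -> : v * ((i%:R - j%:R) / N%:R) / N%:R =
  v * (i%:R - j%:R) * (N%:R^-1 * N%:R^-1) by ring.
rewrite exprMn !expr2 normrM (ger0_norm uu0) ler_wpM2r // normrM.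
apply: (@le_trans _ _ `|i%:R - j%:R|); first by rewrite ler_piMl.
case: (ltngtP i j) => [ij|ij|->]; last by rewrite subrr normr0 mulr0.
  by rewrite ler0_norm; move: ij; rewrite -(ler_nat R) -natr1 => ?; nra.
by rewrite ger0_norm; move: ij; rewrite -(ler_nat R) -natr1 => ?; nra.
Qed.

(** Squared distances below 1 occur only within one pole or bar, where the potential is constant,
    between a post and its own pole or bar, and within one post. The last two follow from
    [post_step], a pole acting as the end 0 of its post and a bar as the end [N]. *)
Lemma potential_lip s t : `|potential g s - potential g t| <= cost pos s t.
Proof.
have sym u v : `|potential g u - potential g v| <= cost pos u v ->
    `|potential g v - potential g u| <= cost pos v u.
  by rewrite distrC costC.
have pole_bar x k y l : `|potential g (inl (inl (x, k))) -
    potential g (inl (inr (y, l)))| <= cost pos (inl (inl (x, k))) (inl (inr (y, l))).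
  apply: potential_far; rewrite /cost /= vec3B enorm_vec3; apply: sum_sqr_ge1.
  by rewrite sub0r sqrrN expr1n; right; left.
have pole_post x k p i : `|potential g (inl (inl (x, k))) -
    potential g (inr (p, i))| <= cost pos (inl (inl (x, k))) (inr (p, i)).
  have [xp|xp] := eqVneq x (val p).1; last first.
    apply: potential_far; rewrite /cost /= vec3B enorm_vec3; apply: sum_sqr_ge1.
    by left; exact: idx_sqrB.
  rewrite /cost /= vec3B enorm_vec3 xp subrr expr0n add0r -mulrBl.
  have -> : g (val p).1 - (g (val p).1 + (g (val p).2 - g (val p).1) *
      (i%:R / N%:R)) = (g (val p).2 - g (val p).1) * (0%:R / N%:R - i%:R / N%:R).
    by ring.
  by apply: (le_trans (post_step 0 i (g_lip (valP p))));
    rewrite mulr0n mul0r lerDl sqr_ge0.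
have bar_post y k p i : `|potential g (inl (inr (y, k))) -
    potential g (inr (p, i))| <= cost pos (inl (inr (y, k))) (inr (p, i)).
  have [yp|yp] := eqVneq y (val p).2; last first.
    apply: potential_far; rewrite /cost /= vec3B enorm_vec3; apply: sum_sqr_ge1.
    by right; right; exact: idx_sqrB.
  rewrite /cost /= vec3B enorm_vec3 yp subrr expr0n addr0 -mulrBl.
  have -> : g (val p).2 - (g (val p).1 + (g (val p).2 - g (val p).1) *
      (i%:R / N%:R)) = (g (val p).2 - g (val p).1) * (1 - i%:R / N%:R).
    by ring.
  have := post_step N i (g_lip (valP p)); rewrite divff ?gt_eqF // => /le_trans.
  by apply; rewrite lerDr sqr_ge0.
have post_post p i q j : `|potential g (inr (p, i)) - potential g (inr (q, j))| <=
    cost pos (inr (p, i)) (inr (q, j)).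
  have [p1|p1] := eqVneq (val p).1 (val q).1; last first.
    apply: potential_far; rewrite /cost /= vec3B enorm_vec3; apply: sum_sqr_ge1.
    by left; exact: idx_sqrB.
  have [p2|p2] := eqVneq (val p).2 (val q).2; last first.
    apply: potential_far; rewrite /cost /= vec3B enorm_vec3; apply: sum_sqr_ge1.
    by right; right; exact: idx_sqrB.
  rewrite /cost /= vec3B enorm_vec3 p1 p2 !subrr expr0n addr0 add0r -mulrBl.
  by rewrite opprD addrACA subrr add0r -mulrBr; exact: post_step i j (g_lip (valP q)).
case: s t => [[[x k]|[x k]]|[p i]] [[[y l]|[y l]]|[q j]] //; try exact: sym.
  have [->|xy] := eqVneq x y; first by rewrite subrr normr0 cost_ge0.
  apply: potential_far; rewrite /cost /= vec3B enorm_vec3; apply: sum_sqr_ge1.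
  by left; exact: idx_sqrB.
have [->|xy] := eqVneq x y; first by rewrite subrr normr0 cost_ge0.
apply: potential_far; rewrite /cost /= vec3B enorm_vec3; apply: sum_sqr_ge1.
by right; right; exact: idx_sqrB.
Qed.

(** With [potential_bnd] this gives the bound by the squared norm in [orbit_dist_potential]. *)
Lemma pos_far s : 1 <= enorm (pos s) ^+ 2.
Proof.
have idx1 x : 1 <= idx x ^+ 2 by rewrite exprn_ege1 // ler1n.
case: s => [[[x k]|[x k]]|[p i]]; rewrite /= enorm_vec3; apply: sum_sqr_ge1.
- by left.
- by right; left; rewrite expr1n.
- by left.
Qed.

Lemma orbit_dist_rep x y :
  (g x - g y) / N%:R <= orbit_dist (config pos (rep x)) (config pos (rep y)) ^+ 2.
Proof.
rewrite mulrBl.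
apply: (@orbit_dist_potential _ _ _ _ (potential g) (rep x) (rep y)) => [s|s t].
  by case/andP: (potential_bnd s) => -> /=; move/le_trans; apply; exact: pos_far.
exact: le_trans (ler_norm _) (potential_lip s t).
Qed.

End Potential.

End Scaffold.

(** * Comparison of the two averages *)

Theorem theorem42 (R : realType) (d : nat) (hd : (3 <= d)%N) :
  c2 (l2quot R d) = (+oo)%E /\
  ~ (exists H : completeNormedModType R, is_hilbert H /\
       exists f : l2quot R d -> H, bilipschitz f).
Proof.
have no_embedding : ~ (exists H : completeNormedModType R, is_hilbert H /\
    exists f : l2quot R d -> H, bilipschitz f).
  move=> [H [[dot dotE] [f [alpha [c [alpha0 bl]]]]]].
  pose r := Num.bound (12 * c ^+ 2); pose T := 'M['F_2]_r.
  have r_gt : 12 * c ^+ 2 < r%:R by apply: archi_boundP; rewrite mulr_ge0 ?sqr_ge0.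
  pose e : rel T := fun x y => (\rank (y - x)%R <= 1)%N.
  have e_refl : reflexive e by move=> x; rewrite /e subrr mxrank0.
  (* The subdivision number [r.+1] is positive and bounds all ranks, as the potentials require. *)
  pose w (x : T) : l2 R d := config (@pos R d _ e r.+1) (rep e r.+1 x).
  pose D x y := orbit_dist (w x) (w y); pose F x := f (l2class (w x)).
  have D0 x y : 0 <= D x y by exact: orbit_dist_ge0.
  have bl_lo x y : alpha * D x y <= `|F x - F y|.
    by case: (bl (l2class (w x)) (l2class (w y))); rewrite mdist_l2class.
  have bl_up x y : `|F x - F y| <= c * alpha * D x y.
    by case: (bl (l2class (w x)) (l2class (w y))); rewrite mdist_l2class.
  have lower x a : alpha ^+ 2 * ((\rank a)%:R / r.+1%:R) <=
      dot (F (x + a) - F x) (F (x + a) - F x).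
    rewrite -dotE; apply: (@le_trans _ _ ((alpha * D (x + a) x) ^+ 2)); last first.
      by rewrite ler_sqr ?nnegrE ?mulr_ge0 ?(ltW alpha0).
    rewrite exprMn ler_wpM2l ?sqr_ge0 //.
    (* The rank distance to [x] is 1-Lipschitz along edges and serves as the potential. *)
    pose g (y : T) : R := (\rank (y - x))%:R.
    have -> : (\rank a)%:R = g (x + a) - g x.
      by rewrite /g subrr mxrank0 subr0 addrC addKr.
    apply: orbit_dist_rep => // [y|y z].
      by rewrite ler0n ler_nat leqW // rank_leq_row.
    rewrite /e => yz.
    have : (\rank (y - x)%R <= \rank (z - x)%R + 1)%N.
      have -> : y - x = (z - x) - (z - y) by rewrite opprB [RHS]addrC subrKA.
      by apply: leq_trans (mxrank_add _ _) _; rewrite mxrank_opp leq_add2l.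
    have : (\rank (z - x)%R <= \rank (y - x)%R + 1)%N.
      have -> : z - x = (y - x) + (z - y) by rewrite [RHS]addrC subrKA.
      by apply: leq_trans (mxrank_add _ _) _; rewrite leq_add2l.
    by rewrite -!(ler_nat R) !natrD /g ler_norml => ? ?; apply/andP; split; lra.
  have upper x (q : 'cV['F_2]_r) (p : 'rV['F_2]_r) :
      dot (F (x + q *m p) - F x) (F (x + q *m p) - F x) <=
      c ^+ 2 * alpha ^+ 2 * (3 / r.+1%:R).
    rewrite -dotE; apply: (@le_trans _ _ ((c * alpha * D (x + q *m p) x) ^+ 2)).
      by rewrite ler_sqr ?nnegrE // (le_trans _ (bl_up _ _)).
    rewrite exprMn -(exprMn _ c) ler_wpM2l ?sqr_ge0 //.
    apply: orbit_dist_reach; apply: reach_rep => //.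
    by rewrite /e opprD addNKr mxrank_opp mulmx_max_rank.
  have := rank_poincare dot F.
  set n1 := #|{: 'cV['F_2]_r}|; set n2 := #|{: 'rV['F_2]_r}|.
  set L := \sum_a _; set U := \sum_(q : 'cV['F_2]_r) _.
  have n1_gt0 : 0 < n1%:R :> R by rewrite ltr0n; apply/card_gt0P; exists 0.
  have n2_gt0 : 0 < n2%:R :> R by rewrite ltr0n; apply/card_gt0P; exists 0.
  have t_gt0 : 0 < #|T|%:R :> R by rewrite ltr0n; apply/card_gt0P; exists 0.
  pose k : R := alpha ^+ 2 / r.+1%:R.
  have k_gt0 : 0 < k by rewrite divr_gt0 // exprn_gt0.
  have L_ge : k * (\sum_(a : T) \rank a)%:R * #|T|%:R <= L.
    rewrite natr_sum mulr_sumr mulr_suml; apply: ler_sum => a _.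
    rewrite mulr_natr -sumr_const; apply: ler_sum => x _.
    by apply: le_trans (lower x a); rewrite /k mulrAC mulrA.
  have U_le : U <= n1%:R * (n2%:R * (#|T|%:R * (3 * c ^+ 2 * k))).
    rewrite mulr_natl -sumr_const; apply: ler_sum => q _.
    rewrite mulr_natl -sumr_const; apply: ler_sum => p _.
    rewrite mulr_natl -sumr_const; apply: ler_sum => x _.
    by apply: le_trans (upper x q p) _; rewrite le_eqVlt /k; apply/orP; left;
      apply/eqP; ring.
  have : (r * #|T|)%:R <= (2 * \sum_(a : T) \rank a)%:R :> R.
    by rewrite ler_nat; exact: sum_rank_ge.
  rewrite !natrM; move: (\sum_(a : T) _)%N L_ge => S L_ge rt_le.
  (* Cancelling the common factors in [L_ge], [LU] and [U_le] leaves [S <= 6 * c ^+ 2 * #|T|]; with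
     [r * #|T| <= 2 * S] this gives the constant 12. *)
  move=> LU; suff : r%:R <= 12 * c ^+ 2 by rewrite leNgt r_gt.
  rewrite -(ler_pM2r t_gt0) (le_trans rt_le) // -(ler_pM2l k_gt0).
  rewrite -(ler_pM2r t_gt0) -(ler_pM2l (mulr_gt0 n1_gt0 n2_gt0)).
  have nn_ge0 : 0 <= n1%:R * n2%:R :> R by rewrite mulr_ge0.
  have t2_ge0 : 0 <= 2 * (2 * #|T|%:R) :> R by rewrite !mulr_ge0.
  have := ler_wpM2l nn_ge0 L_ge; have := ler_wpM2l t2_ge0 U_le.
  move: LU; lra.
split=> //; rewrite /c2.
suff -> : [set c : R | 1 <= c /\ exists H : completeNormedModType R,
    is_hilbert H /\ exists (f : l2quot R d -> H) (alpha : R),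
    0 < alpha /\ bilipschitz_with alpha c f] = set0.
  by rewrite image_set0 ereal_inf0.
rewrite -subset0 => c [_ [H [hH [f [alpha [alpha0 bl]]]]]].
by apply: no_embedding; exists H; split=> //; exists f, alpha, c.
Qed.
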